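(* Let $\Gamma=\mathbb F_2\times\mathbb Z/2\mathbb Z$, where $\mathbb F_2$ is the free group on generators $a,b$ and $\mathbb Z/2\mathbb Z=\{0,1\}$, let $0<\alpha<1$, and let $$\mu=\alpha\,\delta_{(e,0)}+\frac{1-\alpha}{6}\big(\delta_{(a,0)}+\delta_{(a^{-1},0)}+\delta_{(b,0)}+\delta_{(b^{-1},0)}+\delta_{(a,1)}+\delta_{(a^{-1},1)}\big).$$ Then the map $\psi_\mu$ from the $0$-Martin boundary of $(\Gamma,\mu)$ onto the Gromov boundary of $\Gamma$ is not injective. Moreover, the $0$-Martin boundary contains non-minimal $\infty$-harmonic functions, i.e. there is $\xi\in\partial_{M,0}\Gamma$ such that $K(\cdot,\xi\,|\,0)$ is an $\infty$-harmonic function which is not minimal.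
   Context: Write $1_\Gamma=(e,0)$ for the identity, $P^n(x,y)=\mu^{*n}(x^{-1}y)$, $P^0(x,y)=\delta_{x,y}$, and $|x|=\inf\{n\ge0:P^n(1_\Gamma,x)>0\}$. The $0$-Martin kernel is $K(x,y\,|\,0)=P^{|y|-|x|}(x,y)/P^{|y|}(1_\Gamma,y)$ if $|y|=|x|+|x^{-1}y|$, and $0$ otherwise. The $0$-Martin compactification $\Delta_{M,0}\Gamma$ is the smallest compactification of $\Gamma$ (compact Hausdorff, containing $\Gamma$ as a discrete, open, dense subset) to which all functions $y\mapsto K(x,y\,|\,0)$ extend continuously; $\partial_{M,0}\Gamma=\Delta_{M,0}\Gamma\setminus\Gamma$, and $K(\cdot,\xi\,|\,0)$ denotes the limit kernel at $\xi$. $\psi_\mu$ is the continuous surjection from $\Delta_{M,0}\Gamma$ onto the Gromov compactification of the hyperbolic group $\Gamma$ extending the identity of $\Gamma$ (unique by density of $\Gamma$); it maps $\partial_{M,0}\Gamma$ onto the Gromov boundary. Let $\bar\mu_x(y)=\mu(x^{-1}y)$ if $|y|\ge|x|+1$ and $0$ otherwise. A function $h$ on $\Gamma$ is $\infty$-harmonic if $h(x)=\sum_y\bar\mu_x(y)h(y)$ for all $x$. A non-negative $\infty$-harmonic $h$ with $h(1_\Gamma)=1$ is minimal if every non-negative $\infty$-harmonic $g$ with $g\le Ch$ for some $C>0$ is a constant multiple of $h$. *)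

(* Defs.v *)
From HB Require Import structures.
From mathcomp Require Import all_boot all_order all_algebra.
From mathcomp Require Import all_classical all_reals all_analysis.

Set Implicit Arguments.
Unset Strict Implicit.
Unset Printing Implicit Defensive.

Import Order.TTheory GRing.Theory Num.Theory.
Import numFieldNormedType.Exports.

Local Open Scope classical_set_scope.
Local Open Scope ring_scope.

(* The free group on X, as reduced words. The letter (x, false) is the        *)
(* generator x and (x, true) is its inverse.                                  *)
Section FreeGroup.
Variable X : choiceType.

Definition inv_letter (l : X * bool) : X * bool := (l.1, ~~ l.2).

Definition reduced (w : seq (X * bool)) : bool :=
  sorted (fun l m => m != inv_letter l) w.

Definition free_group := {w : seq (X * bool) | reduced w}.

HB.instance Definition _ := Choice.on free_group.
HB.instance Definition _ := SubType.on free_group.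

Definition push (l : X * bool) (w : seq (X * bool)) : seq (X * bool) :=
  if w is m :: w' then (if m == inv_letter l then w' else l :: w) else [:: l].

Lemma inv_letterK : involutive inv_letter.
Proof. by case=> x b; rewrite /inv_letter /= negbK. Qed.

Lemma push_reduced l w : reduced w -> reduced (push l w).
Proof.
case: w => // m w /=; case: eqVneq => [_|ne] pw; first exact: path_sorted pw.
by rewrite /reduced /= ne.
Qed.

Lemma foldr_push_reduced u w : reduced w -> reduced (foldr push w u).
Proof. by move=> rw; elim: u => //= l u; apply: push_reduced. Qed.

Lemma pushK l w : reduced w -> push (inv_letter l) (push l w) = w.
Proof.
case: w => [_|m w] /=; first by rewrite inv_letterK eqxx.
case: eqVneq => [->|_] /=; last by rewrite inv_letterK eqxx.
by case: w => //= k w /andP[/negbTE->].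
Qed.

Lemma foldr_push_push l u w : reduced w ->
  foldr push w (push l u) = push l (foldr push w u).
Proof.
move=> rw; case: u => //= m u; case: eqVneq => //= ->.
by rewrite -{1}(inv_letterK l) pushK // foldr_push_reduced.
Qed.

Lemma foldr_push_id w : reduced w -> foldr push [::] w = w.
Proof.
elim: w => //= l w IH rw; rewrite IH; last exact: path_sorted rw.
by case: w rw {IH} => //= m w /andP[/negbTE->].
Qed.

Lemma inv_word_reduced w : reduced w -> reduced (rev (map inv_letter w)).
Proof.
rewrite /reduced rev_sorted sorted_map; apply: sub_sorted => l m /=.
by apply: contraNN => /eqP->; rewrite !inv_letterK.
Qed.

Definition fg_one : free_group := exist reduced [::] isT.

Definition fg_mul (u v : free_group) : free_group :=
  exist reduced (foldr push (val v) (val u))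
    (foldr_push_reduced (val u) (valP v)).

Definition fg_inv (u : free_group) : free_group :=
  exist reduced (rev (map inv_letter (val u))) (inv_word_reduced (valP u)).

Lemma fg_mulA : associative fg_mul.
Proof.
move=> [u ru] [v rv] [w rw]; apply/val_inj => /= {ru}.
by elim: u => //= l u ->; rewrite foldr_push_push.
Qed.

Lemma fg_mul1 : left_id fg_one fg_mul.
Proof. by move=> u; apply/val_inj. Qed.

Lemma fg_mulr1 : right_id fg_one fg_mul.
Proof. by move=> u; apply/val_inj/foldr_push_id/valP. Qed.

Lemma fg_mulV : left_inverse fg_one fg_inv fg_mul.
Proof.
move=> [u ru]; apply/val_inj => /=.
elim: u ru => //= l u IH ru; rewrite rev_cons foldr_rcons /= inv_letterK eqxx.
exact/IH/(path_sorted ru).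
Qed.

Lemma fg_invK : involutive fg_inv.
Proof.
move=> u; apply/val_inj; rewrite /= map_rev revK -map_comp.
by rewrite (eq_map inv_letterK) map_id.
Qed.

Lemma fg_mulrV : right_inverse fg_one fg_inv fg_mul.
Proof. by move=> u; rewrite -{1}(fg_invK u) fg_mulV. Qed.

HB.instance Definition _ :=
  isGroup.Build free_group fg_mulA fg_mul1 fg_mulr1 fg_mulV fg_mulrV.

Definition free_gen (x : X) : free_group := exist reduced [:: (x, false)] isT.

End FreeGroup.

Section RandomWalk.
Variables (R : realType) (G : groupType) (mu : G -> R).

(* The sums over G are meant for finitely supported mu: the operator          *)
(* \sum_(y \in _) is the sum over the support whenever the support is finite. *)
Fixpoint conv_power (n : nat) (x : G) : R :=
  if n is n'.+1
  then \sum_(y \in [set: G]) mu y * conv_power n' (y^-1 * x)%g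
  else (x == 1%g)%:R.

Definition trans_prob (n : nat) (x y : G) : R := conv_power n (x^-1 * y)%g.

(* The value when no power of mu charges x is irrelevant.                     *)
Definition walk_length (x : G) : nat :=
  match pselect (exists n, 0 < trans_prob n 1%g x) with
  | left ex => ex_minn ex
  | right _ => 0%N
  end.

Definition martin_kernel0 (x y : G) : R :=
  if walk_length y == (walk_length x + walk_length (x^-1 * y)%g)%N
  then trans_prob (walk_length y - walk_length x) x y
       / trans_prob (walk_length y) 1%g y
  else 0.

Definition mu_bar (x y : G) : R :=
  if (walk_length x + 1 <= walk_length y)%N then mu (x^-1 * y)%g else 0.

Definition infty_harmonic (h : G -> R) : Prop :=
  forall x, h x = \sum_(y \in [set: G]) mu_bar x y * h y.

Definition minimal_infty_harmonic (h : G -> R) : Prop :=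
  [/\ forall x, 0 <= h x, infty_harmonic h, h 1%g = 1 &
      forall g : G -> R, (forall x, 0 <= g x) -> infty_harmonic g ->
        (exists2 C : R, 0 < C & forall x, g x <= C * h x) ->
        exists c : R, forall x, g x = c * h x].

Definition extends_kernel0 (T : topologicalType) (i : G -> T)
    (x : G) (f : T -> R) : Prop :=
  continuous f /\ forall y, f (i y) = martin_kernel0 x y.

(* K(x, xi | 0) for xi in a compactification i : G -> T to which K(x, . | 0)  *)
(* extends; the extension is unique by density of the image of i.             *)
Definition martin_kernel0_ext (T : topologicalType) (i : G -> T)
    (x : G) (xi : T) : R :=
  xget (fun=> 0) [set f : T -> R | extends_kernel0 i x f] xi.

End RandomWalk.

(* A compactification of the discrete set G; asking that all the points of G  *)
(* be open says both that G is discrete and that it is open.                  *)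
Definition compactification (G : Type) (T : topologicalType) (i : G -> T) :
    Prop :=
  [/\ compact [set: T], hausdorff_space T, injective i,
      forall x, open [set i x] & dense (range i)].

Definition martin_compactification0 (R : realType) (G : groupType)
    (mu : G -> R) (T : topologicalType) (i : G -> T) : Prop :=
  [/\ compactification i,
      forall x, exists f, extends_kernel0 mu i x f &
      forall (T' : topologicalType) (i' : G -> T'), compactification i' ->
        (forall x, exists f, extends_kernel0 mu i' x f) ->
        exists p : T' -> T, continuous p /\ forall x, p (i' x) = i x].

(* The Gromov compactification of a group for the left invariant metric       *)
(* d(x, y) = len (x^-1 y).                                                    *)
Section Gromov.
Variables (G : groupType) (len : G -> nat).

Definition gromov_product (x y : G) : rat :=
  ((len x)%:R + (len y)%:R - (len (x^-1 * y)%g)%:R) / 2%:R.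

(* liminf_(i, j) (x_i | y_j) >= r for an integer r; eventually being >= r is  *)
(* the same thing because the Gromov product has half-integer values.         *)
Definition liminf_product_ge (x y : nat -> G) (r : nat) : Prop :=
  exists N : nat, forall i j, (N <= i)%N -> (N <= j)%N ->
    r%:R <= gromov_product (x i) (y j).

Definition equivalent_seq (x y : nat -> G) : Prop :=
  forall r, liminf_product_ge x y r.

Definition tends_to_infinity (x : nat -> G) : Prop := equivalent_seq x x.

Definition gromov_class (x : nat -> G) : set (nat -> G) :=
  [set y | tends_to_infinity y /\ equivalent_seq x y].

Definition gromov_boundary : Type :=
  {C : set (nat -> G) | exists2 x, tends_to_infinity x & C = gromov_class x}.

Variant gromov_compactification : Type :=
  | GInterior of G
  | GBoundary of gromov_boundary.

Definition is_gromov_boundary (p : gromov_compactification) : Prop :=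
  if p is GBoundary _ then True else False.

(* Sequences representing a point: the sequences of its class for a boundary  *)
(* point, the constant sequence for an element of G.                          *)
Definition represents (p : gromov_compactification) (y : nat -> G) : Prop :=
  match p with
  | GInterior g => y = fun=> g
  | GBoundary eta => sval eta y
  end.

Definition gromov_nbhs (xi : gromov_boundary) (r : nat) :
    set gromov_compactification :=
  [set p | exists x y, [/\ sval xi x, represents p y & liminf_product_ge x y r]].

Definition gromov_open (U : set gromov_compactification) : Prop :=
  forall xi : gromov_boundary, U (GBoundary xi) ->
    exists r, gromov_nbhs xi r `<=` U.

HB.instance Definition _ := gen_eqMixin gromov_compactification.
HB.instance Definition _ := gen_choiceMixin gromov_compactification.

Lemma gromov_nbhs_le xi r s : (r <= s)%N -> gromov_nbhs xi s `<=` gromov_nbhs xi r.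
Proof.
move=> rs p [x [y [xx py [N HN]]]]; exists x, y; split=> //; exists N => i j Ni Nj.
by apply: le_trans (HN i j Ni Nj); rewrite ler_nat.
Qed.

Lemma gromov_openT : gromov_open setT.
Proof. by move=> xi _; exists 0%N. Qed.

Lemma gromov_openI : setI_closed gromov_open.
Proof.
move=> U V oU oV xi [/oU[r rU] /oV[s sV]]; exists (maxn r s) => p Hp.
split; [apply: rU|apply: sV]; apply: gromov_nbhs_le Hp;
  [exact: leq_maxl|exact: leq_maxr].
Qed.

Lemma gromov_open_bigU (I : Type) (f : I -> set gromov_compactification) :
  (forall i, gromov_open (f i)) -> gromov_open (\bigcup_i f i).
Proof.
move=> of_ xi [i _ /of_[r rf]]; exists r => p /rf fp; by exists i.
Qed.

HB.instance Definition _ := isOpenTopological.Build gromov_compactification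
  gromov_openT gromov_openI gromov_open_bigU.

End Gromov.

Definition Gamma : groupType := (free_group bool * 'Z_2)%type.

Definition gen_a : free_group bool := free_gen false.
Definition gen_b : free_group bool := free_gen true.

Definition gamma_delta (R : realType) (g : free_group bool) (s : 'Z_2)
  (x : Gamma) : R := (x == (g, s))%:R.

Definition mu_alpha (R : realType) (alpha : R) (x : Gamma) : R :=
  alpha * gamma_delta R 1%g 0 x
  + (1 - alpha) / 6%:R *
    (gamma_delta R gen_a 0 x + gamma_delta R gen_a^-1%g 0 x
     + gamma_delta R gen_b 0 x + gamma_delta R gen_b^-1%g 0 x
     + gamma_delta R gen_a 1 x + gamma_delta R gen_a^-1%g 1 x).

(* For this mu the length is the word length of the finite symmetric          *)
(* generating set consisting of the non-trivial elements charged by mu.       *)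
Definition gamma_length (R : realType) (alpha : R) : Gamma -> nat :=
  walk_length (mu_alpha alpha).

(* psi is the continuous surjection from T (a compactification of Gamma, via  *)
(* i) onto the Gromov compactification extending the identity of Gamma.       *)
Definition is_psi_mu (R : realType) (alpha : R) (T : topologicalType)
    (i : Gamma -> T)
    (psi : T -> gromov_compactification (gamma_length alpha)) : Prop :=
  [/\ continuous psi, forall x, psi (i x) = GInterior _ x,
      psi @` setT = setT &
      psi @` (~` range i) = [set p | is_gromov_boundary p]].

(* Main.v *)
Require Import Defs.
From HB Require Import structures.
From mathcomp Require Import all_boot all_order all_algebra.
From mathcomp Require Import all_classical all_reals all_analysis.
From mathcomp Require Import zify ring lra.

Set Implicit Arguments.
Unset Strict Implicit.
Unset Printing Implicit Defensive.

Import Order.TTheory GRing.Theory Num.Theory.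
Import numFieldNormedType.Exports.

Local Open Scope classical_set_scope.
Local Open Scope ring_scope.

(** Two ideas carry the proof.

    Collapsing: a limit kernel h at a boundary point m of the Martin
    compactification is a non-negative harmonic function with h(1) = 1
    ([kernel_ext_harmonic]). The harmonic equation only moves mass outwards, so h
    is positive at points x arbitrarily far from 1 ([infty_harmonic_far]), and
    K(x, . | 0) is then positive near m. Positivity of K(x, y | 0) means that x
    lies on a geodesic from 1 to y, that is, that the Gromov product of x and y
    is |x|. Hence the group elements close to m have large Gromov products with
    each other and determine a single Gromov boundary point. For a hyperbolic
    length this gives the continuous surjection psi ([gromov_map]).
    Gamma is hyperbolic because its length differs by at most 2 from the length
    of the reduced word ([gamma_hyperbolic]).

    Non-minimality: write c for the common mass of the six non-trivial steps. The
    pair (w, t) is reached in as many steps as w has letters with probability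
    c^|w| times the number of ways of distributing t over these letters. Only
    the letters a, a^-1 offer a choice. So (ab^n, 0) and (ab^n, 1) are both
    reached in exactly one way, and (ab^n a, 0) in exactly two, one through each
    of them. In the limit the kernel h of the third sequence is the average of
    the kernels h0, h1 of the first two. The three limits lie over the same end
    ab^oo. The element (a, 1) is on a geodesic to (ab^n, 1) but not on one
    to (ab^n, 0), since (b^n, 1) has length n + 2. So h0 and h1 differ
    at (a, 1), whence psi is not injective, and h0 <= 2 h is not proportional
    to h, whence h is not minimal. The inequalities h0, h1 <= 2 h are
    limits of [kernel_ray_le], and the values at (a, 1) come from
    [kernel_ray_same] and [kernel_ray_diff]. *)

(** * Finitely supported walks *)

Section Walk.
Variables (R : realType) (G : groupType) (mu : G -> R) (S : seq G).
Hypotheses (mu_ge0 : forall x, 0 <= mu x) (S_uniq : uniq S)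
  (mu_supp : forall x, x \notin S -> mu x = 0)
  (mu_reach : forall x, exists n, 0 < conv_power mu n x).

Local Notation len := (walk_length mu).
Local Notation K := (martin_kernel0 mu).

Lemma conv_powerS n x :
  conv_power mu n.+1 x = \sum_(s <- S) mu s * conv_power mu n (s^-1 * x)%g.
Proof.
rewrite /= (fsbigE S) //.
  by apply: eq_bigl => s; rewrite in_setT.
by move=> s _ sS; rewrite mu_supp ?mul0r.
Qed.

Lemma sum_mu_bar x (h : G -> R) :
  \sum_(y \in [set: G]) mu_bar mu x y * h y =
  \sum_(s <- S) mu_bar mu x (x * s)%g * h (x * s)%g.
Proof.
rewrite (fsbigE [seq (x * s)%g | s <- S]).
- by rewrite big_map; apply: eq_bigl => s; rewrite in_setT.
- by rewrite map_inj_uniq //; exact: mulgI.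
- by [].
- move=> y _ yS; rewrite /mu_bar mu_supp ?if_same ?mul0r //.
  by apply: contra yS => yS; apply/mapP; exists (x^-1 * y)%g; rewrite ?mulVKg.
Qed.

Lemma sum_gt0P (F : G -> R) : (forall s, 0 <= F s) ->
  (0 < \sum_(s <- S) F s) -> exists2 s, s \in S & 0 < F s.
Proof.
move=> F0 h; apply: contrapT => nF; move: h; rewrite big1_seq ?ltxx //= => s sS.
apply/eqP; rewrite eq_le F0 andbT leNgt; apply/negP => Fs; apply: nF; by exists s.
Qed.

Lemma sum_ge_term (F : G -> R) s : (forall s, 0 <= F s) -> s \in S ->
  F s <= \sum_(s <- S) F s.
Proof.
by move=> F0 sS; rewrite (bigD1_seq s) //= lerDl sumr_ge0.
Qed.

Lemma conv_power_ge0 n x : 0 <= conv_power mu n x.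
Proof.
elim: n x => [|n IH] x; first by rewrite /= ler0n.
by rewrite conv_powerS sumr_ge0 // => s _; rewrite mulr_ge0.
Qed.
Local Hint Resolve conv_power_ge0 : core.

Lemma conv_term_ge0 n x s : 0 <= mu s * conv_power mu n (s^-1 * x)%g.
Proof. by rewrite mulr_ge0. Qed.

Lemma conv_step_le n x s :
  mu s * conv_power mu n (s^-1 * x)%g <= conv_power mu n.+1 x.
Proof.
rewrite conv_powerS.
have [sS|sS] := boolP (s \in S).
  exact: (@sum_ge_term (fun s => mu s * _ (s^-1 * x)%g) s (conv_term_ge0 n x)).
by rewrite mu_supp // mul0r sumr_ge0 // => t _; rewrite mulr_ge0.
Qed.

Lemma conv_powerSP n x : 0 < conv_power mu n.+1 x ->
  exists2 s, 0 < mu s & 0 < conv_power mu n (s^-1 * x)%g.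
Proof.
rewrite conv_powerS => /(sum_gt0P (conv_term_ge0 n x))[s _ h].
have ms : 0 < mu s.
  by rewrite lt_neqAle mu_ge0 andbT eq_sym; apply/eqP => e; rewrite e mul0r ltxx in h.
by exists s => //; move: h; rewrite pmulr_rgt0.
Qed.

Lemma conv_powerS_gt0 n s x : 0 < mu s -> 0 < conv_power mu n x ->
  0 < conv_power mu n.+1 (s * x)%g.
Proof.
move=> ms px; apply: lt_le_trans (conv_step_le n (s * x)%g s).
by rewrite mulKg mulr_gt0.
Qed.

Lemma conv_power0_gt0 : 0 < conv_power mu 0 1%g.
Proof. by rewrite /= eqxx. Qed.

Lemma conv_power1_gt0 s : 0 < mu s -> 0 < conv_power mu 1 s.
Proof.
by move=> ms; rewrite -[s]mulg1; apply: conv_powerS_gt0; rewrite //= eqxx ltr01.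
Qed.

(** The recursion of [conv_power] peels off the first step; kernels at y and
    at y s are compared by peeling off the last one. *)
Lemma conv_step_right_le n x s :
  conv_power mu n x * mu s <= conv_power mu n.+1 (x * s)%g.
Proof.
elim: n x => [|n IH] x.
  rewrite [conv_power mu 0 x]/(_%:R); case: eqVneq => [->|_].
    have := conv_step_le 0 s s.
    by rewrite mul1g mul1r [conv_power mu 0 _]/(_%:R) mulVg eqxx mulr1.
  by rewrite mul0r conv_power_ge0.
rewrite conv_powerS [leRHS]conv_powerS mulr_suml; apply: ler_sum => t _.
by rewrite -mulrA ler_wpM2l // mulgA.
Qed.

Lemma conv_powerD_gt0 m n x y : 0 < conv_power mu m x ->
  0 < conv_power mu n y -> 0 < conv_power mu (m + n) (x * y)%g.
Proof.
elim: m x => [|m IH] x px py.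
  by move: px; rewrite /= ltr0n lt0b => /eqP->; rewrite mul1g.
have [s ms psx] := conv_powerSP px.
by rewrite -[x](mulVKg s) -mulgA addSn; apply: conv_powerS_gt0 => //; exact: IH.
Qed.

(** * The walk length *)

Lemma walk_lengthP x : 0 < conv_power mu (len x) x.
Proof.
rewrite /walk_length; case: pselect => [ex|nex].
  by case: ex_minnP => n; rewrite /trans_prob invg1 mul1g.
have [n px] := mu_reach x.
by case: nex; exists n; rewrite /trans_prob invg1 mul1g.
Qed.

Lemma walk_length_le n x : 0 < conv_power mu n x -> (len x <= n)%N.
Proof.
move=> px; rewrite /walk_length; case: pselect => [ex|nex] //.
by case: ex_minnP => m _; apply; rewrite /trans_prob invg1 mul1g.
Qed.

Lemma conv_power_lt_length n x : (n < len x)%N -> conv_power mu n x = 0.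
Proof.
move=> nx; apply/eqP; rewrite eq_le conv_power_ge0 andbT leNgt.
by apply: contraL nx => /walk_length_le; rewrite -leqNgt.
Qed.

Lemma walk_lengthM x y : (len (x * y)%g <= len x + len y)%N.
Proof. by apply/walk_length_le/conv_powerD_gt0; exact: walk_lengthP. Qed.

Lemma walk_length1 : len 1%g = 0%N.
Proof. by apply/eqP; rewrite -leqn0; apply: walk_length_le; rewrite /= eqxx. Qed.

Lemma walk_length_eq0 x : (len x == 0%N) = (x == 1%g).
Proof.
apply/eqP/eqP => [e|->]; last exact: walk_length1.
by have := walk_lengthP x; rewrite e /= ltr0n lt0b => /eqP.
Qed.

Lemma walk_length_step s : 0 < mu s -> (len s <= 1)%N.
Proof. by move=> ms; exact/walk_length_le/conv_power1_gt0. Qed.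

Lemma walk_length_triangle x y : (len y <= len x + len (x^-1 * y)%g)%N.
Proof. by rewrite -{1}[y](mulVKg x) walk_lengthM. Qed.

(** Reversing a path inverts its endpoint, and a symmetric walk charges the
    reversed steps. *)
Lemma walk_lengthV x : (forall s, mu s^-1%g = mu s) -> len x^-1%g = len x.
Proof.
move=> muV.
have H n y : 0 < conv_power mu n y -> 0 < conv_power mu n y^-1%g.
  elim: n y => [|n IH] y; first by rewrite /= !ltr0n !lt0b invg_eq1.
  move=> /conv_powerSP[s ms /IH]; rewrite invgM invgK => psy.
  rewrite -[y^-1%g](mulgK s) -addn1; apply: conv_powerD_gt0 => //.
  by apply: conv_power1_gt0; rewrite muV.
apply/eqP; rewrite eqn_leq; apply/andP; split.
  by apply/walk_length_le/H/walk_lengthP.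
by rewrite -{1}[x]invgK; apply/walk_length_le/H/walk_lengthP.
Qed.

(** * The 0-Martin kernel on the group *)

Lemma martin_kernel0_ge0 x y : 0 <= K x y.
Proof. by rewrite /martin_kernel0; case: ifP => // _; rewrite divr_ge0 ?conv_power_ge0. Qed.

(** The kernel detects geodesics: it is positive only when x lies on a
    geodesic from 1 to y. *)
Lemma martin_kernel0_gt0 x y :
  0 < K x y -> len y = (len x + len (x^-1 * y)%g)%N.
Proof. by rewrite /martin_kernel0; case: eqP => //; rewrite ltxx. Qed.

Lemma martin_kernel0E x y : len y = (len x + len (x^-1 * y)%g)%N ->
  K x y = conv_power mu (len (x^-1 * y)%g) (x^-1 * y)%g / conv_power mu (len y) y.
Proof.
move=> e; rewrite /martin_kernel0 /trans_prob {1}e eqxx e addKn -e.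
by rewrite invg1 mul1g.
Qed.

Lemma martin_kernel0_1 y : K 1%g y = 1.
Proof.
rewrite martin_kernel0E invg1 mul1g ?walk_length1 ?add0n // divff //.
by rewrite gt_eqF // walk_lengthP.
Qed.

(** Splitting a shortest path from x to y at its first step. The only first
    steps that contribute on either side go to a point one unit further from 1
    that still lies on a geodesic to y. At x = y there is no first step to split
    off, and the identity fails. *)
Lemma martin_kernel0_harmonic x y : x != y ->
  K x y = \sum_(s <- S) mu_bar mu x (x * s)%g * K (x * s)%g y.
Proof.
move=> xy.
have stepP s : (len x + 1 <= len (x * s)%g)%N -> 0 < mu s ->
   len (x * s)%g = (len x + 1)%N.
  move=> h /walk_length_step ls; apply/eqP; rewrite eqn_leq h andbT.
  by rewrite (leq_trans (walk_lengthM _ _)) // leq_add2l.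
have inv s : ((x * s)^-1 * y = s^-1 * (x^-1 * y))%g by rewrite invgM mulgA.
have tri s : 0 < mu s ->
    (len (x^-1 * y)%g <= 1 + len (s^-1 * (x^-1 * y))%g)%N.
  move=> /walk_length_step ls; apply: leq_trans (walk_length_triangle s _) _.
  by rewrite leq_add2r.
(* If x is not on a geodesic to y, neither is any successor of x. *)
have [e|ne] := eqVneq (len y) (len x + len (x^-1 * y)%g)%N; last first.
  rewrite {1}/martin_kernel0 (negbTE ne) big1 // => s _.
  rewrite /mu_bar; case: ifP => h; last by rewrite mul0r.
  rewrite mulKg; have := mu_ge0 s; rewrite le_eqVlt => /orP[/eqP<-|ms].
    by rewrite mul0r.
  rewrite /martin_kernel0; case: eqP => [e|]; last by rewrite mulr0.
  case/eqP: ne; apply/eqP; rewrite eqn_leq walk_length_triangle /= e inv.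
  by rewrite stepP // -addnA leq_add2l tri.
rewrite martin_kernel0E //.
have : (0 < len (x^-1 * y)%g)%N.
  rewrite lt0n walk_length_eq0; apply: contra xy => /eqP e1.
  by rewrite -[y](mulVKg x) e1 mulg1.
case E: (len _) => [//|k] _; rewrite conv_powerS mulr_suml; apply: eq_bigr => s _.
rewrite /mu_bar mulKg; have := mu_ge0 s; rewrite le_eqVlt => /orP[/eqP<-|ms].
  by rewrite if_same !mul0r.
(* Either x s is off the geodesics to y and both terms vanish, or it is one
   step closer to y and both terms agree. *)
have [l|l] := ltnP k (len (s^-1 * (x^-1 * y))%g).
  rewrite conv_power_lt_length // mulr0 mul0r /martin_kernel0.
  case: ifP => h; last by rewrite mul0r.
  rewrite ifN ?mulr0 //; rewrite inv e E stepP //; apply/eqP; lia.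
have {}l : len (s^-1 * (x^-1 * y))%g = k.
  by apply/eqP; rewrite eqn_leq l -ltnS -E -add1n tri.
have lxs : len (x * s)%g = (len x + 1)%N.
  apply/eqP; rewrite eqn_leq; apply/andP; split.
    apply: leq_trans (walk_lengthM _ _) _.
    by rewrite leq_add2l walk_length_step.
  have := walk_length_triangle (x * s)%g y; rewrite inv l e E; lia.
rewrite lxs leqnn martin_kernel0E inv l ?e ?lxs ?E -?addnA ?add1n //.
by rewrite -mulrA.
Qed.

(** When y s is one unit further from 1 than y, a geodesic from x to y extends
    to y s. The quotient of probabilities corrects the normalisations, so that
    the constant is the conditional probability that a geodesic path from 1 to
    y s passes through y. *)
Lemma martin_kernel0_step_le x y s : 0 < mu s ->
    len (y * s)%g = (len y).+1 ->
  mu s * (conv_power mu (len y) y / conv_power mu (len y).+1 (y * s)%g) * K x y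
    <= K x (y * s)%g.
Proof.
move=> ms lys.
have := martin_kernel0_ge0 x y; rewrite le_eqVlt => /orP[/eqP<-|Kxy].
  by rewrite mulr0 martin_kernel0_ge0.
have ly := martin_kernel0_gt0 Kxy.
have l : len (x^-1 * (y * s))%g = (len (x^-1 * y)%g).+1.
  apply/eqP; rewrite eqn_leq; apply/andP; split.
    rewrite mulgA (leq_trans (walk_lengthM _ _)) // -addn1 leq_add2l.
    exact: walk_length_step.
  by rewrite -(ltn_add2l (len x)) -ly -lys walk_length_triangle.
rewrite [K x (y * s)%g]martin_kernel0E ?lys ?l ?ly ?addnS // -ly.
rewrite martin_kernel0E //.
have Py : conv_power mu (len y) y != 0 by rewrite gt_eqF // walk_lengthP.
have Pys : conv_power mu (len y).+1 (y * s)%g != 0.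
  by rewrite -lys gt_eqF // walk_lengthP.
rewrite [leLHS](_ : _ =
  conv_power mu (len (x^-1 * y)%g) (x^-1 * y)%g * mu s
    / conv_power mu (len y).+1 (y * s)%g).
  by rewrite ler_wpM2r ?invr_ge0 // mulgA conv_step_right_le.
by field; apply/andP.
Qed.

(** * Limit kernels at the boundary *)

Section BoundaryKernel.
Variables (T : topologicalType) (i : G -> T).
Hypotheses (Ti : compactification i)
  (K_ext : forall x, exists f, extends_kernel0 mu i x f).
Local Notation Kext := (martin_kernel0_ext mu i).

Lemma kernel_extP x : extends_kernel0 mu i x (Kext x).
Proof.
have [f ef] := K_ext x.
by apply: (@xgetPex _ _ [set f | extends_kernel0 mu i x f]); exists f.
Qed.

Lemma kernel_ext_cont x : continuous (Kext x).
Proof. by case: (kernel_extP x). Qed.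

Lemma kernel_extE x y : Kext x (i y) = K x y.
Proof. by case: (kernel_extP x). Qed.

(** A boundary point is a limit of group elements different from any given x.
    This is how identities valid off x, such as [martin_kernel0_harmonic], pass
    to the boundary. *)
Lemma closed_boundary (A : set T) x : closed A ->
  (forall y, y != x -> A (i y)) -> forall m, ~ range i m -> A m.
Proof.
move=> cA Ay m mb; apply: contrapT => nAm.
have [_ hT _ _ dn] := Ti.
have [||q [[nAq qx] [y _ yq]]] := dn (~` A `&` ~` [set i x]).
- by exists m; split=> //= mx; apply: mb; exists x.
- apply: openI; first exact: closed_openC.
  by apply/closed_openC/accessible_closed_set1/hausdorff_accessible.
apply: nAq; rewrite -yq; apply: Ay; apply/eqP => yx.
by apply: qx; rewrite -yq yx.
Qed.

Lemma kernel_ext_ge0 x m : ~ range i m -> 0 <= Kext x m.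
Proof.
apply: (@closed_boundary [set m | 0 <= Kext x m] x) => [|y _ /=].
  by move/continuous_closedP: (@kernel_ext_cont x) => /(_ _ (@closed_ge _ 0)).
by rewrite kernel_extE martin_kernel0_ge0.
Qed.

Lemma kernel_ext1 m : ~ range i m -> Kext 1%g m = 1.
Proof.
apply: (@closed_boundary [set m | Kext 1%g m = 1] 1%g) => [|y _ /=].
  by move/continuous_closedP: (@kernel_ext_cont 1%g) => /(_ _ (@closed_eq _ 1)).
by rewrite kernel_extE martin_kernel0_1.
Qed.

Lemma kernel_ext_harmonic m : ~ range i m ->
  infty_harmonic mu (fun x => Kext x m).
Proof.
move=> mb x; rewrite sum_mu_bar; apply/eqP; rewrite -subr_eq0; apply/eqP.
pose D p := Kext x p - \sum_(s <- S) mu_bar mu x (x * s)%g * Kext (x * s)%g p.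
have Dc : continuous D.
  move=> p; apply: cvgB; first exact: kernel_ext_cont.
  apply: cvg_big => [|s _]; first exact: add_continuous.
  by apply: cvgM; [exact: cvg_cst|exact: kernel_ext_cont].
move: mb; apply: (@closed_boundary [set p | D p = 0] x) => [|y yx /=].
  by move/continuous_closedP: Dc => /(_ _ (@closed_eq _ 0)).
rewrite /D kernel_extE; under eq_bigr do rewrite kernel_extE.
by rewrite -martin_kernel0_harmonic ?subrr // eq_sym.
Qed.

(** If h(x) > 0, some term of the sum expressing h(x) is positive, and all these
    terms live at points of larger length. *)
Lemma infty_harmonic_far (h : G -> R) : (forall x, 0 <= h x) ->
  infty_harmonic mu h -> 0 < h 1%g ->
  forall n, exists2 x, (n <= len x)%N & 0 < h x.
Proof.
move=> h0 hh h1; elim=> [|n [x nx hx]]; first by exists 1%g.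
move: hx; rewrite hh sum_mu_bar => /(@sum_gt0P (fun s => mu_bar mu x (x * s)%g * h (x * s)%g)).
case=> [s|s _]; first by rewrite /mu_bar; case: ifP; rewrite ?mul0r ?mulr_ge0.
rewrite /mu_bar; case: ifP; rewrite ?mul0r ?ltxx // => le hxs.
exists (x * s)%g; first by rewrite (leq_trans _ le) // addn1.
by rewrite lt_neqAle h0 andbT; apply: contraTneq hxs => <-; rewrite mulr0 ltxx.
Qed.

(** The only information on the walk that the map to the Gromov boundary uses:
    group elements near m are all reached by geodesics through a common point
    that can be taken arbitrarily far from 1. *)
Lemma boundary_geodesics m : ~ range i m -> forall n, exists x,
  (n <= len x)%N /\
  \forall p \near m, forall y, p = i y -> len y = (len x + len (x^-1 * y)%g)%N.
Proof.
move=> mb n.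
have h1 : 0 < Kext 1%g m by rewrite kernel_ext1.
have [x nx hx] :=
  infty_harmonic_far (fun x => @kernel_ext_ge0 x m mb) (kernel_ext_harmonic mb) h1 n.
exists x; split=> //.
have pos : nbhs m (Kext x @^-1` [set r | 0 < r]) :=
  kernel_ext_cont (open_nbhs_nbhs (conj (@open_gt _ 0) hx)).
apply: filterS pos => p /= hp y py; apply: martin_kernel0_gt0.
by rewrite -kernel_extE -py.
Qed.
End BoundaryKernel.
End Walk.

(** * The Gromov boundary of a hyperbolic length *)

(** An ultrafilter makes all sequences in a compact space converge at once, so
    that the kernels along several sequences can be compared index by index
    without extracting subsequences. *)
Lemma compact_ultra_lim (X : Type) (T : topologicalType) (U : set_system X)
    (u : X -> T) :
  compact [set: T] -> UltraFilter U -> exists m : T, u @ U --> m.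
Proof.
move=> Tc UU; have [m [_ cm]] := Tc (u @ U) _ filterT.
exists m => B mB; have [//|nB] := in_ultra_setVsetC (u @^-1` B) UU.
by have [p [np Bp]] := cm (~` B) B nB mB.
Qed.

Section Hyperbolic.
Variables (G : groupType) (len : G -> nat) (delta : nat).
Local Notation gp := (gromov_product len).
Hypotheses (lenV : forall x, len x^-1%g = len x)
  (gp_hyperbolic : forall (r : nat) x y z,
     (r + delta)%:R <= gp x y -> (r + delta)%:R <= gp y z -> r%:R <= gp x z).

Lemma gromov_productC x y : gp x y = gp y x.
Proof.
rewrite /gromov_product addrC [(len x)%:R + _]addrC [in RHS]addrC.
by rewrite -[len (y^-1 * x)%g]lenV invgM invgK addrC.
Qed.

Lemma equivalent_seq_sym x y :
  equivalent_seq len x y -> equivalent_seq len y x.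
Proof.
move=> xy r; have [N HN] := xy r.
by exists N => i j Ni Nj; rewrite gromov_productC HN.
Qed.

Lemma equivalent_seq_trans y x z : equivalent_seq len x y ->
  equivalent_seq len y z -> equivalent_seq len x z.
Proof.
move=> xy yz r; have [N HN] := xy (r + delta)%N.
have [P HP] := yz (r + delta)%N.
exists (maxn N P) => i j; rewrite !geq_max => /andP[Ni Pi] /andP[Nj Pj].
by apply: (@gp_hyperbolic _ _ (y (maxn N P))); [apply: HN|apply: HP];
  rewrite // ?leq_maxl ?leq_maxr.
Qed.

Definition boundary_of (x : nat -> G) (hx : tends_to_infinity len x) :
    gromov_compactification len :=
  GBoundary (exist _ (gromov_class len x) (ex_intro2 _ _ x hx erefl)).

Lemma boundary_of_eq x y (hx : tends_to_infinity len x)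
    (hy : tends_to_infinity len y) :
  equivalent_seq len x y -> boundary_of hx = boundary_of hy.
Proof.
move=> xy; congr GBoundary; apply: eq_exist => /=.
apply/seteqP; split=> z [hz h]; split=> //.
  exact: equivalent_seq_trans (equivalent_seq_sym xy) h.
exact: equivalent_seq_trans xy h.
Qed.

Lemma boundary_ofP (eta : gromov_boundary len) :
  exists x (hx : tends_to_infinity len x), GBoundary eta = boundary_of hx.
Proof.
case: eta => C [x hx CE]; exists x, hx; congr GBoundary; exact: eq_exist.
Qed.

Lemma gromov_product_diag x : len 1%g = 0%N -> gp x x = (len x)%:R.
Proof.
move=> l1; rewrite /gromov_product mulVg l1 subr0; lra.
Qed.

Section Map.
Variables (T : topologicalType) (i : G -> T).
Hypotheses (len1 : len 1%g = 0%N) (Ti : compactification i).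
Hypothesis boundary_geodesic : forall m, ~ range i m -> forall n : nat,
  exists x, (n <= len x)%N /\
    \forall p \near m, forall y, p = i y -> len y = (len x + len (x^-1 * y)%g)%N.

Lemma near_interior (m : T) (P : set T) : (\forall p \near m, P p) -> exists y, P (i y).
Proof.
case: Ti => _ _ _ _ dn; rewrite -nbhs_nearE nbhsE => -[B [oB Bm] BP].
have B0 : B !=set0 by exists m.
by have [q [Bq [y _ yE]]] := dn B B0 oB; exists y; apply: BP; rewrite yE.
Qed.

(** Uniform form of the convergence of x to the same boundary point as m: the
    neighbourhood of m is chosen before the index n and works for all large
    n. *)
Definition tracks (x : nat -> G) (m : T) := forall r : nat, exists N : nat,
  \forall p \near m, forall n y, (N <= n)%N -> p = i y -> r%:R <= gp (x n) y.

(** Points x n of length at least n on geodesics to all elements near m have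
    Gromov product at least n with these elements. *)
Lemma tracks_ex m : ~ range i m -> exists x, tracks x m.
Proof.
move=> mb; have [x Hx] := choice (boundary_geodesic mb).
have gx n : \forall p \near m, forall y, p = i y -> n%:R <= gp (x n) y.
  have [nx] := Hx n; apply: filterS => p h y /h e.
  rewrite /gromov_product e natrD.
  rewrite (_ : _ / _ = (len (x n))%:R) ?ler_nat //; lra.
(* x n and x N are compared through an element near m, and then x n and y
   through x N: hyperbolicity is used twice. *)
exists x => r; pose N := (r + delta + delta)%N; exists N.
apply: filterS (gx N) => p hN n y Nn /hN {}hN.
have [y0] := near_interior (filterI (gx n) (gx N)).
move=> [/(_ _ erefl) h1 /(_ _ erefl) h2].
have h3 : (r + delta)%:R <= gp (x N) (x n).
  apply: (@gp_hyperbolic _ _ y0) => //.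
  by rewrite gromov_productC; apply: le_trans h1; rewrite ler_nat.
apply: (@gp_hyperbolic _ _ (x N)); first by rewrite gromov_productC.
by apply: le_trans hN; rewrite ler_nat leq_addr.
Qed.

Lemma tracks_equivalent m x z :
  tracks x m -> tracks z m -> equivalent_seq len x z.
Proof.
move=> xm zm r; have [N HN] := xm (r + delta)%N; have [P HP] := zm (r + delta)%N.
have [y] := near_interior (filterI HN HP) => -[h1 h2].
exists (maxn N P) => k j; rewrite !geq_max => /andP[Ni Pi] /andP[Nj Pj].
apply: (@gp_hyperbolic _ _ y); first exact: h1.
by rewrite gromov_productC; exact: h2.
Qed.

Lemma tracks_tends_to_infinity m x : tracks x m -> tends_to_infinity len x.
Proof. by move=> xm; exact: (tracks_equivalent xm). Qed.

Section Limit.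
Variables (F : set_system nat) (FF : ProperFilter F) (z : nat -> G) (m : T).
Hypotheses (F_oo : \oo `<=` F) (zm : i \o z @ F --> m)
  (hz : tends_to_infinity len z).

Lemma preimage_nbhs_limit (B : set T) : nbhs m B -> F ((i \o z) @^-1` B).
Proof. exact: zm. Qed.

(** Points of the group are isolated in T, so a sequence converging to one of
    them would take it as a value infinitely often. *)
Lemma limit_boundary : ~ range i m.
Proof.
case: Ti => _ _ inj op _ [g _ gm].
have Fg : F [set k | z k = g].
  have : nbhs m [set i g].
    by rewrite -gm; apply: open_nbhs_nbhs; split; [exact: op|].
  by move=> /preimage_nbhs_limit; apply: filterS => k /= /inj.
have [N HN] := hz (len g).+1.
have [k [/= kg Nk]] := filter_ex (filterI Fg (F_oo (nbhs_infty_ge N))).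
have := HN k k Nk Nk; rewrite gromov_product_diag // ler_nat kg.
by rewrite ltnn.
Qed.

Lemma tracks_limit x : tracks x m -> equivalent_seq len x z.
Proof.
move=> xm r; have [N HN] := xm (r + delta)%N; have [P HP] := hz (r + delta)%N.
have [k [/= kN Pk]] := filter_ex (filterI (preimage_nbhs_limit HN) (F_oo (nbhs_infty_ge P))).
exists (maxn N P) => l j; rewrite !geq_max => /andP[Nl Pl] /andP[Nj Pj].
apply: (@gp_hyperbolic _ _ (z k)); first exact: kN.
exact: HP.
Qed.
End Limit.

(** Send m to the class of any sequence tracking it. Continuity follows from
    the uniformity in [tracks], and every class is reached because a limit in T
    of one of its sequences is tracked by an equivalent sequence. The last
    clause computes psi at limits of explicit sequences. *)
Lemma gromov_map :
  exists psi : T -> gromov_compactification len,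
   [/\ continuous psi, forall x, psi (i x) = GInterior _ x,
      psi @` setT = setT,
      psi @` (~` range i) = [set p | is_gromov_boundary p] &
      forall (F : set_system nat) (FF : ProperFilter F) (z : nat -> G) (m : T),
        \oo `<=` F -> i \o z @ F --> m ->
        forall hz : tends_to_infinity len z, psi m = boundary_of hz].
Proof.
have [_ _ inj iopen _] := Ti; have [Tc _ _ _ _] := Ti.
pose spec m p := (forall y, m = i y -> p = GInterior len y) /\
   (~ range i m -> exists x (hx : tends_to_infinity len x),
      tracks x m /\ p = boundary_of hx).
have [psi Hpsi] : {psi & forall m, spec m (psi m)}.
  apply: choice => m; have [[g _ gm]|mb] := pselect (range i m).
    exists (GInterior len g); split; last by case; exists g.
    by move=> y; rewrite -gm => /inj->.
  have [x xm] := tracks_ex mb.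
  exists (boundary_of (tracks_tends_to_infinity xm)); split.
    by move=> y my; case: mb; exists y.
  by move=> _; exists x, (tracks_tends_to_infinity xm).
have psi_int y : psi (i y) = GInterior len y by apply: (Hpsi (i y)).1.
have psi_lim (F : set_system nat) (FF : ProperFilter F) (z : nat -> G) (m : T) :
    \oo `<=` F -> i \o z @ F --> m ->
    forall hz : tends_to_infinity len z, psi m = boundary_of hz.
  move=> F_oo zm hz; have mb := limit_boundary FF F_oo zm hz.
  have [x [hx [xm ->]]] := (Hpsi m).2 mb.
  exact/boundary_of_eq/(tracks_limit FF F_oo zm).
have psi_onto eta : exists2 m, ~ range i m & psi m = GBoundary eta.
  have [z [hz ->]] := boundary_ofP eta.
  have [U [UU U_oo]] := ultraFilterLemma eventually_filter.
  have [m zm] := compact_ultra_lim (i \o z) Tc UU.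
  exists m; first exact: limit_boundary U_oo zm hz.
  exact: psi_lim U_oo zm hz.
exists psi; split=> //.
- apply/continuousP => A oA; rewrite openE => m /= Am; rewrite /interior.
  have [[g _ gm]|mb] := pselect (range i m).
    rewrite -gm in Am *; apply: filterS (open_nbhs_nbhs _); last first.
      by split; [exact: (iopen g)|].
    by move=> _ /= ->.
  have [x [hx [xm mE]]] := (Hpsi m).2 mb.
  rewrite mE in Am; have [r rA] := (oA : gromov_open A) _ Am.
  have [N /near_join HN] := xm (r + delta)%N.
  apply: filterS HN => p Hp; apply: rA.
  have [[g _ gp]|pb] := pselect (range i p).
    exists x, (fun=> g); split; first by split.
      by rewrite -gp psi_int.
    exists N => k j Nk _; have /= := nbhs_singleton Hp.
    move=> /(_ k g Nk (esym gp)); apply: le_trans.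
    by rewrite ler_nat leq_addr.
  have [z [hz [zp pE]]] := (Hpsi p).2 pb.
  exists x, z; split; first by split.
    by rewrite pE; split.
  have [P HP] := zp (r + delta)%N.
  have [y [h1 h2]] := near_interior (filterI Hp HP).
  exists (maxn N P) => k j; rewrite !geq_max => /andP[Nk Pk] /andP[Nj Pj].
  apply: (@gp_hyperbolic _ _ y); first exact: h1.
  by rewrite gromov_productC; exact: h2.
- apply/seteqP; split=> // -[g|eta] _.
    by exists (i g).
  by have [m _ mE] := psi_onto eta; exists m.
- apply/seteqP; split=> [_ [m mb <-]|[//|eta] _].
    by have [x [hx [_ ->]]] := (Hpsi m).2 mb.
  by have [m mb mE] := psi_onto eta; exists m.
Qed.

End Map.
End Hyperbolic.

(** * Reduced words and common prefixes *)

Section CommonPrefix.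
Variable T : eqType.

Fixpoint lcp (u v : seq T) : nat :=
  match u, v with
  | x :: u', y :: v' => if x == y then (lcp u' v').+1 else 0
  | _, _ => 0
  end.

Lemma lcp_ultrametric u v w : (minn (lcp u v) (lcp v w) <= lcp u w)%N.
Proof.
elim: u v w => [|x u IH] [|y v] [|z w] //=; rewrite ?minn0 ?min0n //.
have [->|xy] := eqVneq x y; last by rewrite min0n.
by have [_|yz] := eqVneq y z; rewrite ?minn0 // minnSS ltnS.
Qed.

Lemma lcp_nseq (x : T) m n u v : (minn m n <= lcp (nseq m x ++ u) (nseq n x ++ v))%N.
Proof. by elim: m n => [|m IH] [|n] //=; rewrite eqxx minnSS ltnS. Qed.

End CommonPrefix.

Section FreeGroupSize.
Variable X : choiceType.
Implicit Types u v : free_group X.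

Lemma size_push_le l (w : seq (X * bool)) : (size (push l w) <= (size w).+1)%N.
Proof. by case: w => //= m w; case: ifP => //= _; rewrite ltnW. Qed.

Lemma size_fg_mul_le u v : (size (val (u * v)%g) <= size (val u) + size (val v))%N.
Proof.
case: u => u ru; rewrite /= => {ru}.
by elim: u => //= l u IH; rewrite (leq_trans (size_push_le _ _)) ?addSn ?ltnS.
Qed.

(** In u^-1 v exactly the common prefix cancels, once in each word. *)
Lemma size_fg_divl u v :
  (size (val (u^-1 * v)%g) + (lcp (val u) (val v)).*2 =
   size (val u) + size (val v))%N.
Proof.
case: u v => [u ru] [v rv] /=.
elim: u v ru rv => [|l u IH] v ru rv /=; first by rewrite addn0.
have ru' : reduced u := path_sorted ru.
have lcp0 w : lcp u (inv_letter l :: w) = 0%N.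
  by case: (u) ru => //= m u' /andP[/negbTE->].
rewrite rev_cons foldr_rcons.
have push_add : push (inv_letter l) v = inv_letter l :: v ->
    lcp (l :: u) v = 0%N ->
    (size (foldr (@push X) (push (inv_letter l) v) (rev (map (@inv_letter X) u)))
       + (lcp (l :: u) v).*2 = (size u).+1 + size v)%N.
  move=> pE ->; have := push_reduced (inv_letter l) rv.
  by rewrite pE => /(IH _ ru'); rewrite lcp0 => ->; rewrite addnS.
case: v rv push_add => [|m v] rv; first by apply.
rewrite [push _ (m :: v)]/= inv_letterK [lcp _ _]/= (eq_sym l m).
case: eqVneq => [_ _|_]; last by apply.
by have := IH v ru' (path_sorted rv); rewrite doubleS /=; lia.
Qed.

Definition letter (l : X * bool) : free_group X := exist (@reduced X) [:: l] isT.

Lemma free_gen_inv g : (free_gen g)^-1%g = letter (g, true).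
Proof. exact: val_inj. Qed.

Lemma letter_inv l : (letter l)^-1%g = letter (inv_letter l).
Proof. exact: val_inj. Qed.

(** Induction on the reduced word, phrased with products in the group. *)
Lemma free_group_ind (P : free_group X -> Prop) : P 1%g ->
  (forall l u, val (letter l * u)%g = l :: val u -> P u -> P (letter l * u)%g) ->
  forall u, P u.
Proof.
move=> P1 PM [w rw]; elim: w rw => [|l w IH] rw.
  by suff -> : exist _ [::] rw = 1%g :> free_group X by []; apply: val_inj.
have lw : push l w = l :: w by case: w rw {IH} => //= k v /andP[/negbTE->].
pose u : free_group X := exist (@reduced X) w (path_sorted rw).
have lu : val (letter l * u)%g = l :: val u by [].
suff -> : exist _ (l :: w) rw = (letter l * u)%g :> free_group X by exact/PM/IH.
exact: val_inj.
Qed.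

Definition positive_word u := all (fun l : X * bool => ~~ l.2) (val u).

(** No cancellation can occur between generators, so products of positive
    words are computed by concatenation. *)
Lemma val_letter_mul_positive l u : ~~ l.2 -> positive_word u ->
  val (letter l * u)%g = l :: val u.
Proof.
case: u => -[|m w] rw //= pl /andP[/= pm _] /=.
by case: eqVneq pm => // -> /=; rewrite pl.
Qed.

Lemma positive_letter_mul l u : ~~ l.2 -> positive_word u ->
  positive_word (letter l * u)%g.
Proof.
by move=> pl pu; rewrite /positive_word val_letter_mul_positive //= pl.
Qed.

Lemma val_letter_exp_mul_positive l n u : ~~ l.2 -> positive_word u ->
  val (letter l ^+ n * u)%g = nseq n l ++ val u.
Proof.
move=> pl pu; suff [] : val (letter l ^+ n * u)%g = nseq n l ++ val u /\
  positive_word (letter l ^+ n * u)%g by [].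
elim: n => [|n [IH pn]]; first by rewrite expg0 mul1g.
rewrite expgS -mulgA; split; last exact: positive_letter_mul.
by rewrite val_letter_mul_positive // IH.
Qed.

Lemma positive_letter_exp_mul l n u : ~~ l.2 -> positive_word u ->
  positive_word (letter l ^+ n * u)%g.
Proof.
move=> pl pu; rewrite /positive_word val_letter_exp_mul_positive // all_cat.
by rewrite all_nseq pl orbT.
Qed.

Lemma size_letter_divl l m u : val (letter l * u)%g = l :: val u -> m != l ->
  size (val ((letter m)^-1 * (letter l * u))%g) = (size (val u)).+2.
Proof.
move=> lu ml; rewrite letter_inv.
rewrite [val _]/(push (inv_letter m) (val (letter l * u)%g)) lu /=.
by rewrite inv_letterK eq_sym (negbTE ml).
Qed.

End FreeGroupSize.

(** * The walk on F2 x Z/2 *)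

Lemma sum_seq6 (V : nmodType) (I : Type) (F : I -> V) s1 s2 s3 s4 s5 s6 :
  \sum_(s <- [:: s1; s2; s3; s4; s5; s6]) F s =
  F s1 + F s2 + F s3 + F s4 + F s5 + F s6.
Proof. by rewrite !big_cons big_nil addr0 !addrA. Qed.

Section GammaWalk.
Variables (R : realType) (alpha : R).
Hypotheses (alpha_gt0 : 0 < alpha) (alpha_lt1 : alpha < 1).
Local Notation mu := (mu_alpha alpha).
Local Notation c := ((1 - alpha) / 6%:R).
Local Notation len := (walk_length mu).
Local Notation K := (martin_kernel0 mu).
Implicit Types x y : Gamma.

Definition gamma_steps : seq Gamma :=
  [:: (letter (false, false), 0); (letter (false, true), 0);
      (letter (true, false), 0); (letter (true, true), 0);
      (letter (false, false), 1); (letter (false, true), 1)].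

Definition gamma_support : seq Gamma := 1%g :: gamma_steps.

Lemma gamma_support_uniq : uniq gamma_support.
Proof. by []. Qed.

Lemma mu_alphaE x : mu x = alpha * (x == 1%g)%:R +
  c * \sum_(s <- gamma_steps) (x == s)%:R.
Proof.
rewrite /mu_alpha /gamma_delta /gen_a /gen_b !free_gen_inv /gamma_steps.
by rewrite sum_seq6.
Qed.

Lemma step_mass_gt0 : 0 < c.
Proof. by rewrite divr_gt0 ?subr_gt0 ?ltr0n. Qed.
Local Hint Resolve step_mass_gt0 : core.

Lemma mu_alpha_ge0 x : 0 <= mu x.
Proof.
rewrite mu_alphaE; apply: addr_ge0; apply: mulr_ge0; rewrite ?ler0n //.
- exact: ltW.
- exact: ltW step_mass_gt0.
- by apply: sumr_ge0 => s _; rewrite ler0n.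
Qed.

Lemma mu_alpha_supp x : x \notin gamma_support -> mu x = 0.
Proof.
rewrite mu_alphaE in_cons negb_or => /andP[/negbTE-> xS].
rewrite big1_seq ?mulr0 ?addr0 // => s /= sS.
by case: eqP => // xs; rewrite xs sS in xS.
Qed.

Lemma mu_alpha_nontrivial s : s \in gamma_steps -> mu s = c.
Proof.
move=> sS; have /andP[s1 uS] := gamma_support_uniq.
rewrite mu_alphaE (_ : (s == 1%g) = false); last by apply: contraNF s1 => /eqP<-.
rewrite (bigD1_seq s) //= eqxx big1 ?mulr0 ?add0r ?addr0 ?mulr1 // => t ts.
by rewrite eq_sym (negbTE ts).
Qed.

Lemma mu_letter0 l : mu (letter l, 0) = c.
Proof. by case: l => [[] []]; apply: mu_alpha_nontrivial. Qed.

Lemma mu_letter1 b : mu (letter (false, b), 1) = c.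
Proof. by case: b; apply: mu_alpha_nontrivial. Qed.

Lemma mu_alphaV s : mu s^-1%g = mu s.
Proof.
have suppV t : t \in gamma_steps -> t^-1%g \in gamma_steps.
  by rewrite !inE; do ?[case/orP]; move/eqP->.
have [sS|sS] := boolP (s \in gamma_steps).
  by rewrite !mu_alpha_nontrivial // suppV.
have [->|s1] := eqVneq s 1%g; first by rewrite invg1.
have s1S : s \notin gamma_support by rewrite in_cons negb_or s1.
rewrite !mu_alpha_supp // in_cons negb_or invg_eq1 s1 /=.
by apply: contra sS => /suppV; rewrite invgK.
Qed.

Lemma size_le_time n x : 0 < conv_power mu n x -> (size (val x.1) <= n)%N.
Proof.
elim: n x => [|n IH] x; first by rewrite [conv_power _ _ _]/(_%:R) ltr0n lt0b => /eqP->.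
move=> /(conv_powerSP mu_alpha_ge0 gamma_support_uniq mu_alpha_supp)[s ms /IH].
have s1 : (size (val s.1) <= 1)%N.
  have : s \in gamma_support.
    by apply: contraTT ms => /mu_alpha_supp->; rewrite ltxx.
  by rewrite !inE; do ?[case/orP]; move/eqP->.
have := size_fg_mul_le s.1 (s^-1 * x)%g.1.
by rewrite -[(_ * _.1)%g]/(s * (s^-1 * x))%g.1 mulVKg; lia.
Qed.

Lemma conv_power_word (u : free_group bool) :
  0 < conv_power mu (size (val u)) ((u, 0) : Gamma).
Proof.
elim/free_group_ind: u => [|l u lu IH]; first exact: conv_power0_gt0.
rewrite lu (_ : (_, 0) = ((letter l, 0) : Gamma) * (u, 0) :> Gamma)%g.
  apply: (conv_powerS_gt0 mu_alpha_ge0 gamma_support_uniq mu_alpha_supp) => //.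
  by rewrite mu_letter0.
by congr pair; rewrite /= mulg1.
Qed.

(** A word with Z/2 coordinate 1 can be reached by inserting (a, 1) (a^-1, 0)
    in front of it. *)
Lemma conv_power_flip (u : free_group bool) :
  0 < conv_power mu (size (val u)).+2 ((u, 1) : Gamma).
Proof.
have step := conv_powerS_gt0 mu_alpha_ge0 gamma_support_uniq mu_alpha_supp.
have -> : (u, 1) = (((letter (false, false), 1%R) : Gamma) *
   (((letter (false, true), 0%R) : Gamma) * (u, 0%R)))%g :> Gamma.
  congr pair; rewrite /= ?mulg1 //.
  have -> : letter (false, true) = (letter (false, false))^-1%g.
    by rewrite letter_inv.
  by rewrite mulVKg.
apply: (step); first by rewrite mu_letter1.
apply: (step); first by rewrite mu_letter0.
exact: conv_power_word.
Qed.

Lemma Z2P (t : 'Z_2) : t = 0 \/ t = 1.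
Proof. by case: t => [[|[|//]] ?]; [left|right]; apply: val_inj. Qed.

Lemma mu_alpha_reach x : exists n, 0 < conv_power mu n x.
Proof.
case: x => u t; have [->|->] := Z2P t.
  by exists (size (val u)); exact: conv_power_word.
by exists (size (val u)).+2; exact: conv_power_flip.
Qed.

Lemma gamma_length_ge x : (size (val x.1) <= len x)%N.
Proof. exact/size_le_time/walk_lengthP/mu_alpha_reach. Qed.

Lemma gamma_length_le x : (len x <= (size (val x.1)).+2)%N.
Proof.
case: x => u t; have [->|->] := Z2P t; last first.
  exact/walk_length_le/conv_power_flip.
have le0 := walk_length_le (conv_power_word u).
exact: leq_trans le0 (leq_addl 2 _).
Qed.

(** The length in Gamma exceeds the length of the word by at most 2, so the
    Gromov product differs by a bounded amount from the length of the common
    prefix, which is the Gromov product of the tree. *)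
Lemma gromov_product_le x y :
  gromov_product len x y <= (lcp (val x.1) (val y.1) + 2)%:R.
Proof.
have := size_fg_divl x.1 y.1; rewrite -[(_ * _.1)%g]/(x^-1 * y)%g.1.
have := gamma_length_ge (x^-1 * y)%g.
have := gamma_length_le x; have := gamma_length_le y.
rewrite /gromov_product ler_pdivrMr // -natrM lerBlDr -!natrD ler_nat; lia.
Qed.

Lemma gromov_product_ge x y :
  (lcp (val x.1) (val y.1))%:R <= gromov_product len x y + 1.
Proof.
have := size_fg_divl x.1 y.1; rewrite -[(_ * _.1)%g]/(x^-1 * y)%g.1.
have := gamma_length_le (x^-1 * y)%g.
have := gamma_length_ge x; have := gamma_length_ge y.
rewrite -lerBlDr /gromov_product ler_pdivlMr // mulrBl mul1r.
rewrite lerBrDr addrAC lerBlDr -natrM -!natrD ler_nat; lia.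
Qed.

(** Common prefixes are ultrametric; the error 3 is the sum of the errors 2
    and 1 in [gromov_product_le] and [gromov_product_ge]. *)
Lemma gamma_hyperbolic (r : nat) x y z :
  (r + 3)%:R <= gromov_product len x y ->
  (r + 3)%:R <= gromov_product len y z -> r%:R <= gromov_product len x z.
Proof.
move=> /le_trans/(_ (gromov_product_le _ _)); rewrite ler_nat => xy.
move=> /le_trans/(_ (gromov_product_le _ _)); rewrite ler_nat => yz.
rewrite -(lerD2r 1); apply: le_trans (gromov_product_ge _ _).
rewrite natr1 ler_nat.
have := lcp_ultrametric (val x.1) (val y.1) (val z.1); lia.
Qed.
Lemma conv_power_lt_size n x : (n < size (val x.1))%N -> conv_power mu n x = 0.
Proof.
move=> nx; apply/eqP; rewrite eq_le.
rewrite (conv_power_ge0 mu_alpha_ge0 gamma_support_uniq mu_alpha_supp) andbT leNgt.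
by apply: contraL nx => /size_le_time; rewrite -leqNgt.
Qed.

(** In as many steps as there are letters, the first step must be the first
    letter: any other step leaves a word too long for the remaining time. Only
    an a-letter leaves a choice for the Z/2 coordinate. *)
Lemma conv_power_letter l (u : free_group bool) (t : 'Z_2) :
  val (letter l * u)%g = l :: val u ->
  conv_power mu (size (val u)).+1 ((letter l * u)%g, t) =
  c * (conv_power mu (size (val u)) (u, t) +
       if l.1 then 0 else conv_power mu (size (val u)) (u, t - 1)).
Proof.
move=> lu; set n := size (val u).
have term m (s : 'Z_2) :
    conv_power mu n (((letter m, s) : Gamma)^-1 * ((letter l * u)%g, t))%g =
    if m == l then conv_power mu n (u, t - s) else 0.
  case: eqVneq => [->|ml].
    congr conv_power; congr pair; first by rewrite /= mulKg.
    by rewrite addrC.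
  by apply: conv_power_lt_size; rewrite (size_letter_divl lu ml).
rewrite (conv_powerS gamma_support_uniq mu_alpha_supp) /gamma_support big_cons.
rewrite conv_power_lt_size ?mulr0 ?add0r; last first.
  by rewrite invg1 mul1g lu.
rewrite /gamma_steps sum_seq6 !term !mu_letter0 !mu_letter1 subr0.
by case: l {lu term} => [[] []]; rewrite !xpair_eqE /=; ring.
Qed.

(** * Counting geodesics along the end ab^oo *)

Local Notation a := (letter (false, false)).
Local Notation b := (letter (true, false)).

Lemma conv_power_bexp n (u : free_group bool) (t : 'Z_2) : positive_word u ->
  conv_power mu (n + size (val u)) ((b ^+ n * u)%g, t) =
  c ^+ n * conv_power mu (size (val u)) (u, t).
Proof.
move=> pu; elim: n => [|n IH]; first by rewrite expg0 mul1g mul1r.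
have pn : positive_word (b ^+ n * u)%g by exact: positive_letter_exp_mul.
have sz : size (val (b ^+ n * u)%g) = (n + size (val u))%N.
  by rewrite val_letter_exp_mul_positive // size_cat size_nseq.
have bE := @val_letter_mul_positive _ (true, false) _ isT pn.
by rewrite expgS -mulgA addSn -sz (conv_power_letter _ bE) addr0 sz IH exprS mulrA.
Qed.

Lemma conv_power_a (u : free_group bool) (t : 'Z_2) : positive_word u ->
  conv_power mu (size (val u)).+1 ((a * u)%g, t) =
  c * (conv_power mu (size (val u)) (u, t) +
       conv_power mu (size (val u)) (u, t - 1)).
Proof.
move=> pu.
exact: (conv_power_letter t (@val_letter_mul_positive _ (false, false) _ isT pu)).
Qed.

Lemma conv_power0E (t : 'Z_2) : conv_power mu 0 (1%g, t) = (t == 0)%:R.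
Proof. by []. Qed.

Lemma indicator_Z2_sum (t : 'Z_2) : (t == 0)%:R + (t - 1 == 0)%:R = 1 :> R.
Proof. by case: (Z2P t) => -> /=; rewrite ?addr0 ?add0r. Qed.

Definition ray (t : 'Z_2) n : Gamma := ((a * b ^+ n)%g, t).
Definition ray_a n : Gamma := ((a * (b ^+ n * a))%g, 0).

Lemma conv_power_b n (t : 'Z_2) :
  conv_power mu n ((b ^+ n)%g, t) = c ^+ n * (t == 0)%:R.
Proof.
have := @conv_power_bexp n 1%g t isT.
by rewrite mulg1 addn0.
Qed.

Lemma val_b n : val (b ^+ n)%g = nseq n (true, false).
Proof. by rewrite -[(b ^+ n)%g]mulg1 val_letter_exp_mul_positive ?cats0. Qed.

Lemma positive_b n : positive_word (b ^+ n)%g.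
Proof. by rewrite /positive_word val_b all_nseq orbT. Qed.

Lemma val_ray t n : val (ray t n).1 = (false, false) :: nseq n (true, false).
Proof. by rewrite val_letter_mul_positive ?positive_b // val_b. Qed.

Lemma val_ray_a n : val (ray_a n).1 =
  (false, false) :: nseq n (true, false) ++ [:: (false, false)].
Proof.
rewrite val_letter_mul_positive ?positive_letter_exp_mul //.
by rewrite val_letter_exp_mul_positive.
Qed.

Lemma conv_power_ray t n : conv_power mu n.+1 (ray t n) = c ^+ n.+1.
Proof.
have sz : size (val (b ^+ n)%g) = n by rewrite val_b size_nseq.
have := conv_power_a t (positive_b n).
by rewrite sz => ->; rewrite !conv_power_b -mulrDr indicator_Z2_sum mulr1 exprS.
Qed.

Lemma conv_power_ray_a n : conv_power mu n.+2 (ray_a n) = 2 * c ^+ n.+2.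
Proof.
have Pa t : conv_power mu 1 (a, t) = c.
  have := @conv_power_a 1%g t isT.
  by rewrite mulg1 !conv_power0E indicator_Z2_sum mulr1.
have sz : size (val (b ^+ n * a)%g) = n.+1.
  by rewrite val_letter_exp_mul_positive // size_cat size_nseq addn1.
have pba : positive_word (b ^+ n * a)%g by exact: positive_letter_exp_mul.
have := conv_power_a 0 pba; rewrite sz => ->.
have Pba t : conv_power mu n.+1 ((b ^+ n * a)%g, t) = c ^+ n.+1.
  have := @conv_power_bexp n a t isT.
  have -> : size (val (a : free_group bool)) = 1%N by [].
  by rewrite addn1 Pa exprSr.
by rewrite !Pba (exprS c n.+1); ring.
Qed.

Lemma length_ray t n : len (ray t n) = n.+1.
Proof.
apply/eqP; rewrite eqn_leq walk_length_le ?conv_power_ray ?exprn_gt0 //=.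
by have := gamma_length_ge (ray t n); rewrite val_ray /= size_nseq.
Qed.

Lemma length_ray_a n : len (ray_a n) = n.+2.
Proof.
apply/eqP; rewrite eqn_leq walk_length_le ?conv_power_ray_a /=; last first.
  by rewrite mulr_gt0 ?ltr0n ?exprn_gt0.
have := gamma_length_ge (ray_a n); rewrite val_ray_a /= size_cat size_nseq /=.
by rewrite addn1.
Qed.

(** One of the two ways of reaching (ab^n a, 0) passes through (ab^n, t). *)
Lemma kernel_ray_le t x n : 2^-1 * K x (ray t n) <= K x (ray_a n).
Proof.
have rs : (ray t n * ((a, t) : Gamma))%g = ray_a n.
  congr pair; first by rewrite /= mulgA.
  by have [->|->] := Z2P t; apply: val_inj.
have mus : mu (a, t) = c.
  by have [->|->] := Z2P t; rewrite ?mu_letter0 ?mu_letter1.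
have := martin_kernel0_step_le mu_alpha_ge0 gamma_support_uniq mu_alpha_supp
  mu_alpha_reach x (y := ray t n) (s := (a, t)).
rewrite rs length_ray length_ray_a mus conv_power_ray conv_power_ray_a.
move=> /(_ step_mass_gt0 erefl); apply: le_trans.
(* The constant is c times c^(n+1) / (2 c^(n+2)). *)
rewrite (_ : c * _ = 2^-1) // (exprS c n.+1).
have c0 : c != 0 by rewrite gt_eqF.
have cn : c ^+ n.+1 != 0 by rewrite expf_neq0.
move: c0 cn; set d := c; set e := d ^+ n.+1 => c0 cn.
by field; apply/andP.
Qed.

Lemma divl_ray (s t : 'Z_2) n :
  (((a, s) : Gamma)^-1 * ray t n)%g = ((b ^+ n)%g, t - s).
Proof.
by congr pair; [rewrite /= mulKg | rewrite addrC].
Qed.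

Lemma kernel_ray_same s n : K (a, s) (ray s n) = c^-1.
Proof.
have la : len ((a, s) : Gamma) = 1%N.
  have := length_ray s 0; rewrite /ray expg0 mulg1; exact.
have lb : len ((b ^+ n)%g, s - s) = n.
  rewrite subrr; apply/eqP; rewrite eqn_leq walk_length_le /=; last first.
    by rewrite conv_power_b eqxx mulr1 exprn_gt0.
  by have := gamma_length_ge ((b ^+ n)%g, 0); rewrite /= val_b size_nseq.
rewrite martin_kernel0E divl_ray ?la ?lb ?length_ray //.
rewrite conv_power_ray conv_power_b subrr eqxx mulr1 exprS invfM.
by rewrite mulrA mulrAC mulfV ?mul1r // expf_neq0 // gt_eqF.
Qed.

(** A geodesic from 1 to (ab^n, t) through (a, s) would reach (b^n, t - s) in n
    steps, but without a-letter the coordinate in Z/2 cannot change. *)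
Lemma kernel_ray_diff s t n : s != t -> K (a, s) (ray t n) = 0.
Proof.
move=> st; rewrite /martin_kernel0 divl_ray; case: eqP => // e.
have la : len ((a, s) : Gamma) = 1%N.
  have := length_ray s 0; rewrite /ray expg0 mulg1; exact.
move: e; rewrite la length_ray add1n => -[e].
have := walk_lengthP mu_alpha_reach ((b ^+ n)%g, t - s).
by rewrite -e conv_power_b subr_eq0 eq_sym (negbTE st) mulr0 ltxx.
Qed.

Lemma ray_equivalent (y z : nat -> Gamma) u v :
  (forall n, val (y n).1 = (false, false) :: nseq n (true, false) ++ u) ->
  (forall n, val (z n).1 = (false, false) :: nseq n (true, false) ++ v) ->
  equivalent_seq len y z.
Proof.
move=> yE zE r; exists r => j k rj rk.
rewrite -(lerD2r 1); apply: le_trans (gromov_product_ge _ _).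
rewrite natr1 ler_nat yE zE /= ltnS; apply: leq_trans (lcp_nseq _ _ _ _ _).
by rewrite leq_min rj.
Qed.

End GammaWalk.

(** * Non-injectivity and non-minimality *)

Unset Implicit Arguments.

Theorem proposition5p5 (R : realType) (alpha : R)
    (alpha_gt0 : 0 < alpha) (alpha_lt1 : alpha < 1)
    (M : topologicalType) (i : Gamma -> M)
    (HM : martin_compactification0 (mu_alpha alpha) i) :
  (exists psi : M -> gromov_compactification (gamma_length alpha),
     is_psi_mu i psi /\ ~ set_inj (~` range i) psi) /\
  (exists xi : M, (~` range i) xi /\
     let h : Gamma -> R := fun x => martin_kernel0_ext (mu_alpha alpha) i x xi in
     [/\ forall x, 0 <= h x, infty_harmonic (mu_alpha alpha) h, h 1%g = 1 &
         ~ minimal_infty_harmonic (mu_alpha alpha) h]).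
Proof.
have [Mi Kx _] := HM.
pose mu := mu_alpha alpha; pose len := walk_length mu.
pose Kext := martin_kernel0_ext mu i.
have mu0 := mu_alpha_ge0 alpha_gt0 alpha_lt1.
have reach := mu_alpha_reach alpha_gt0 alpha_lt1.
have lenV x : len x^-1%g = len x.
  by apply: (walk_lengthV mu0 (gamma_support_uniq) (@mu_alpha_supp R alpha)) => //;
     exact: mu_alphaV.
have len1 : len 1%g = 0%N by exact: walk_length1.
have geo := boundary_geodesics mu0 gamma_support_uniq (@mu_alpha_supp R alpha)
  reach Mi Kx.
have hyp := gamma_hyperbolic alpha_gt0 alpha_lt1.
have [psi [psi_c psi_i psi_T psi_b psi_lim]] := gromov_map lenV hyp len1 Mi geo.
have [U [UU U_oo]] := ultraFilterLemma eventually_filter.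
have [Mc _ _ _ _] := Mi.
have [m rm] := choice (fun t => compact_ultra_lim (i \o ray t) Mc UU).
have [ma rma] := compact_ultra_lim (i \o ray_a) Mc UU.
have ray_inf s t : equivalent_seq len (ray s) (ray t).
  by apply: (ray_equivalent alpha_gt0 alpha_lt1 (u := [::]) (v := [::])) => n;
     rewrite val_ray cats0.
have ray_a_inf : tends_to_infinity len ray_a.
  by apply: (ray_equivalent alpha_gt0 alpha_lt1) => n; exact: val_ray_a.
have mb t : ~ range i (m t).
  exact: (limit_boundary len1 Mi _ U_oo (rm t) (ray_inf t t)).
have mab : ~ range i ma by exact: (limit_boundary len1 Mi _ U_oo rma).
have Klim x y p : i \o y @ U --> p -> martin_kernel0 mu x (y n) @[n --> U] --> Kext x p.
  move=> yp; rewrite (_ : (fun n => _) = Kext x \o (i \o y)).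
    exact: cvg_comp yp (kernel_ext_cont Kx (x := x) (x0 := p)).
  by apply/funext => n; exact: (esym (kernel_extE Kx x (y n))).
have K_le t x : 2^-1 * Kext x (m t) <= Kext x ma.
  apply: (ler_cvg_to (cvgM (cvg_cst (2^-1 : R)) (Klim x _ _ (rm t))) (Klim x _ _ rma)).
  by apply: nearW => n; exact: kernel_ray_le.
pose a1 : Gamma := (letter (false, false), 1).
have K0 : Kext a1 (m 0) <= 0.
  apply: (ler_cvg_to (Klim a1 _ _ (rm 0)) (cvg_cst 0)).
  by apply: nearW => n; rewrite (kernel_ray_diff alpha_gt0 alpha_lt1).
have K1 : 0 < Kext a1 (m 1).
  apply: lt_le_trans (_ : ((1 - alpha) / 6%:R)^-1 <= _).
    by rewrite invr_gt0 step_mass_gt0.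
  apply: (ler_cvg_to (cvg_cst _) (Klim a1 _ _ (rm 1))).
  by apply: nearW => n; rewrite (kernel_ray_same alpha_gt0 alpha_lt1).
split.
  exists psi; split; first by split.
  move=> inj; have : m 0 = m 1.
    apply: inj; rewrite ?inE; [exact: mb|exact: mb|].
    rewrite (psi_lim U _ _ _ U_oo (rm 0) (ray_inf 0 0)).
    rewrite (psi_lim U _ _ _ U_oo (rm 1) (ray_inf 1 1)).
    exact: (boundary_of_eq lenV hyp).
  by move=> m01; move: K0; rewrite m01 leNgt K1.
have h0 p x : ~ range i p -> 0 <= Kext x p.
  exact: (kernel_ext_ge0 mu0 gamma_support_uniq (@mu_alpha_supp R alpha)).
have h1 p : ~ range i p -> Kext 1%g p = 1.
  exact: (kernel_ext1 reach Mi Kx).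
have hh p : ~ range i p -> infty_harmonic mu (fun x => Kext x p).
  exact: (kernel_ext_harmonic mu0 gamma_support_uniq (@mu_alpha_supp R alpha)).
exists ma; split=> // h; split=> [x|||[_ _ _ hmin]].
- exact: h0.
- exact: hh.
- exact: h1.
have [x|||k kE] := hmin (fun x => Kext x (m 0)).
- exact: h0.
- exact: hh.
- exists 2; rewrite ?ltr0n // => x.
  by rewrite -ler_pdivrMl ?ltr0n //; exact: K_le.
have {}kE x : Kext x (m 0) = k * Kext x ma by exact: kE.
have k1 : k = 1 by have := kE 1%g; rewrite !h1 // mulr1.
have := K_le 1 a1; have := kE a1; rewrite k1 mul1r => <-.
by rewrite leNgt (le_lt_trans K0) // mulr_gt0 // invr_gt0 ltr0n.
Qed.
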